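(* Let $\mathcal{M}$ be a Markov chain on a finite state space $\Omega$, let $\mathrm{d}$ be an integer-valued metric on $\Omega\times\Omega$, and let $S=\{(X,Y)\in\Omega\times\Omega:\mathrm{d}(X,Y)=1\}$. Let $(X_t,Y_t)$ be a path coupling for $\mathcal{M}$ with respect to $S$. For any initial states $(X_0,Y_0)\in S$, let $T$ be the stopping time given by the minimum $t$ such that $\mathrm{d}(X_t,Y_t)\neq 1$. Suppose that there are $p>0$ and $\alpha<1$ such that, for all initial states $(X_0,Y_0)\in S$: (i) $\Pr(T=t\mid T\geq t)\geq p$, independently for each $t\ge 1$; (ii) $\mathbf{E}[\mathrm{d}(X_T,Y_T)]\leq\alpha<1$. Then $\mathcal{M}$ mixes rapidly. In particular, the mixing time $\tau(\varepsilon)$ of $\mathcal{M}$ satisfies $$\tau(\varepsilon)\ \leq\ \frac{1}{p}\cdot\frac{3}{1-\alpha}\,\ln(eD_2)\,\ln\Big(\frac{2D_1}{\varepsilon(1-\alpha)}\Big),$$ where $D_1=\max\{\mathrm{d}(X,Y):X,Y\in\Omega\}$ and $D_2=\max\{\mathrm{d}(X_T,Y_T):X_0,Y_0\in\Omega,\ \mathrm{d}(X_0,Y_0)=1\}$ (the maximum over all such initial pairs and all values attained with positive probability).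
   Context: The chain is a discrete-time, time-homogeneous Markov chain with transition matrix $P$ and stationary distribution $\pi$. Its mixing time is $\tau(\varepsilon)=\min\{t:\ \max_{x\in\Omega} d_{TV}(P^{t'}(x,\cdot),\pi)\leq\varepsilon\ \text{for all } t'\ge t\}$, for $0<\varepsilon<1$, where $d_{TV}$ is total variation distance. Path coupling setting: the metric $\mathrm{d}$ is the path metric generated by $S$, i.e. any $X,Y\in\Omega$ are joined by a sequence $X=Z_0,Z_1,\dots,Z_r=Y$ with $r=\mathrm{d}(X,Y)$ and every $(Z_{i},Z_{i+1})\in S$. A path coupling assigns to each pair $(X,Y)\in S$ a joint distribution of a pair $(X',Y')\in\Omega\times\Omega$ whose marginals are $P(X,\cdot)$ and $P(Y,\cdot)$. It is extended to a (Markovian) coupling on all pairs $(X,Y)\in\Omega\times\Omega$ by composing the one-step couplings of consecutive pairs $(Z_i,Z_{i+1})$ along a path $X=Z_0,Z_1,\dots,Z_r=Y$ with $r=\mathrm{d}(X,Y)$ and every $(Z_i,Z_{i+1})\in S$. In particular, while $\mathrm{d}(X_t,Y_t)=1$ the pair $(X_t,Y_t)$ evolves according to the joint distribution assigned to that pair of states.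
   Formalization: The displayed bound is stated only when D_2 > 0, since ln(eD_2) is undefined if every adjacent pair coalesces on leaving distance 1 or if S is empty; when D_2 = 0 only the existence of the mixing time is claimed. *)

(* Defs.v *)
From HB Require Import structures.
From mathcomp Require Import all_boot all_order all_algebra.
From mathcomp Require Import all_classical all_reals all_analysis.

Set Implicit Arguments.
Unset Strict Implicit.
Unset Printing Implicit Defensive.

Import Order.TTheory GRing.Theory Num.Theory.

Local Open Scope classical_set_scope.
Local Open Scope ring_scope.

Section MarkovChains.
Context {R : realType} {Omega : finType}.
Implicit Types (mu nu pi : Omega -> R) (P : Omega -> Omega -> R).

Definition is_distribution mu : Prop :=
  (forall x, 0 <= mu x) /\ \sum_x mu x = 1.

Definition is_transition P : Prop := forall x, is_distribution (P x).

Definition is_stationary P pi : Prop :=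
  is_distribution pi /\ forall y, \sum_x pi x * P x y = pi y.

(* [tpow P t x y] is the t-step transition probability P^t(x, y). *)
Fixpoint tpow P (t : nat) (x y : Omega) : R :=
  if t is t'.+1 then \sum_z P x z * tpow P t' z y else (x == y)%:R.

Definition tv_dist mu nu : R := 2^-1 * \sum_x `|mu x - nu x|.

Definition mixed_from P pi (eps : R) (t : nat) : Prop :=
  forall t', (t <= t')%N ->
    \big[Order.max/0]_(x : Omega) tv_dist (tpow P t' x) pi <= eps.

(* tau = min {t : mixed_from P pi eps t}; a relation because the set could be
   empty for an arbitrary chain. *)
Definition is_mixing_time P pi (eps : R) (tau : nat) : Prop :=
  mixed_from P pi eps tau /\
  forall t, mixed_from P pi eps t -> (tau <= t)%N.

(* Joint distributions with marginals mu and nu; total mass 1 is implied when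
   mu or nu is a distribution. *)
Definition is_coupling mu nu (J : Omega * Omega -> R) : Prop :=
  [/\ forall z, 0 <= J z,
      forall x, \sum_y J (x, y) = mu x &
      forall y, \sum_x J (x, y) = nu y].

End MarkovChains.

Section PathCoupling.
Context {R : realType} {Omega : finType}.
Variable d : Omega -> Omega -> nat.
Implicit Types (P : Omega -> Omega -> R).

Definition is_metric : Prop :=
  [/\ forall x y, d x y = 0%N <-> x = y,
      forall x y, d x y = d y x &
      forall x y z, (d x z <= d x y + d y z)%N].

Definition unit_pair : rel Omega := fun x y => d x y == 1%N.

(* Z_0 = x, Z_1, ..., Z_r = y with r = d x y and consecutive states adjacent;
   p is the list Z_1, ..., Z_r. *)
Definition geodesic (x y : Omega) (p : seq Omega) : Prop :=
  [/\ path unit_pair x p, last x p = y & size p = d x y].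

Definition is_path_metric : Prop :=
  is_metric /\ forall x y, exists p, geodesic x y p.

(* Joint law of the end points (Z_0', Z_r') when (Z_0', ..., Z_r') is sampled
   by drawing Z_0' from P(Z_0, .) and then each Z_{i+1}' from the law
   q(Z_i, Z_{i+1}) conditioned on the value of Z_i'.  By the Markov property of
   this sequence, the law of (Z_0', Z_r') is the sum over z = Z_1' of
   q(Z_0, Z_1)(Z_0', z) * Pr(Z_r' = y' | Z_1' = z); the conditional probability
   is the joint law of (Z_1', Z_r') divided by P(Z_1, z).  When P(Z_1, z) = 0
   the factor q(Z_0, Z_1)(Z_0', z) vanishes too, so 0^-1 = 0 is harmless.  For
   r = 0 both copies move together, and for r = 1 the result is q(Z_0, Z_1). *)
Fixpoint compose_couplings P (q : Omega -> Omega -> Omega * Omega -> R)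
    (x : Omega) (p : seq Omega) (w : Omega * Omega) : R :=
  if p is z :: p' then
    \sum_z' q x z (w.1, z') / P z z' * compose_couplings P q z p' (z', w.2)
  else P x w.1 * (w.1 == w.2)%:R.

(* Q is the transition kernel, on pairs of states, of the Markovian coupling
   that extends a path coupling q given on adjacent pairs only. *)
Definition is_path_coupling P (Q : Omega * Omega -> Omega * Omega -> R) : Prop :=
  exists q : Omega -> Omega -> Omega * Omega -> R,
    (forall x y, unit_pair x y -> is_coupling (P x) (P y) (q x y)) /\
    (forall x y, exists p, geodesic x y p /\
       forall w, Q (x, y) w = compose_couplings P q x p w).

(* The first t such that d(X_t, Y_t) <> 1 along a trajectory; None stands for
   the value +oo. *)
Definition stop_time (z : nat -> Omega * Omega) : option nat :=
  match pselect (exists t, d (z t).1 (z t).2 != 1%N) with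
  | left ex_t => Some (ex_minn ex_t)
  | right _ => None
  end.

Definition stop_ge (t : nat) (z : nat -> Omega * Omega) : Prop :=
  if stop_time z is Some s then (t <= s)%N else True.

(* d(X_T, Y_T), with the convention 0 where T = +oo.  This does not matter when
   Pr(T = t | T >= t) >= p > 0 for all t, since T is then finite almost surely. *)
Definition stop_dist (z : nat -> Omega * Omega) : nat :=
  if stop_time z is Some t then d (z t).1 (z t).2 else 0%N.

Definition diameter : nat := (\max_(x : Omega) \max_(y : Omega) d x y)%N.

End PathCoupling.

Section Processes.
Context {R : realType} {Omega : finType} {disp : measure_display}
        {W : measurableType disp}.

(* Time-homogeneous Markov chain on a finite set with transition kernel Q
   started at z0, given by its finite-dimensional distributions. *)
Definition is_markov_chain (E : finType) (Q : E -> E -> R)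
    (Pr : probability W R) (Z : nat -> W -> E) (z0 : E) : Prop :=
  (forall t z, measurable [set w | Z t w = z]) /\
  (forall (n : nat) (s : nat -> E),
     Pr [set w | forall i, (i <= n)%N -> Z i w = s i] =
     ((s 0%N == z0)%:R * \prod_(i < n) Q (s i) (s i.+1))%:E).

Definition cond_prob (Pr : probability W R) (A B : set W) : R :=
  fine (Pr (A `&` B)) / fine (Pr B).

(* D_2: maximum of the values of d(X_T, Y_T) attained with positive
   probability, over all initial states z at distance 1.  Here Pr z is the law
   under which the pair process starts at z.  The distances are bounded by the
   diameter, whence the range of k. *)
Definition max_stop_dist (d : Omega -> Omega -> nat)
    (Pr : Omega * Omega -> probability W R)
    (Z : nat -> W -> Omega * Omega) : nat :=
  (\max_(z : Omega * Omega | unit_pair d z.1 z.2)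
     \max_(k < (diameter d).+1 |
             (0 < Pr z [set w | stop_dist d (Z ^~ w) = k])%E) k)%N.

End Processes.

(* Main.v *)
(* The n-step expectations of a 1-Lipschitz function phi differ by at most
   d(x, y) times their maximal difference b_n over adjacent pairs.  Stopping
   the coupling of an adjacent pair at T gives the renewal inequality
     b_n <= Pr(T > n) + sum_(k <= n) E[d(X_T, Y_T); T = k] b_(n - k).
   The sequence 2 / (1 - alpha) * exp(- gamma (n + 1)), for
   gamma = p (1 - alpha) / (3 ln(e D_2)), is a supersolution because
   E[d(X_T, Y_T) exp(gamma T)] <= 1 - exp(gamma) (1 - alpha) / 2.  In that
   expectation exp(gamma T) is compared with the constant exp(gamma t0), where
   t0 is about ln(D_2) / p: below t0 one uses E[d(X_T, Y_T)] <= alpha, and above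
   t0 one uses d(X_T, Y_T) <= D_2 and the geometric tail of T.  Choosing phi to
   be half the sign of P^n(x, .) - pi turns the decay of b_n into one of the
   total variation distance. *)
Require Import Defs.
From HB Require Import structures.
From mathcomp Require Import all_boot all_order all_algebra.
From mathcomp Require Import all_classical all_reals all_analysis.
From mathcomp Require Import measurable_realfun.
From mathcomp Require Import ring lra.

Set Implicit Arguments.
Unset Strict Implicit.
Unset Printing Implicit Defensive.

Import Order.TTheory GRing.Theory Num.Theory.

Local Open Scope classical_set_scope.
Local Open Scope ring_scope.

(** * Elementary estimates for exponentials and logarithms *)

Lemma expR_le_inv (R : realType) (x : R) : x < 1 -> expR x <= (1 - x)^-1.
Proof.
move=> x1; rewrite -[x in expR x]opprK expRN lef_pV2 ?posrE ?expR_gt0 //.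
  exact: expR_ge1Dx.
by lra.
Qed.

Lemma ln2_ge (R : realType) : 3 / 5 <= ln 2 :> R.
Proof.
rewrite -ler_expR lnK ?posrE //.
(* It suffices that [expR (1 / 5) <= 5 / 4], since the cube of 5/4 is 125/64, below 2. *)
have -> : 3 / 5 = 1 / 5 * 3%:R :> R by lra.
rewrite expRM_natr; apply: (@le_trans _ _ ((5 / 4) ^+ 3)); last by lra.
rewrite lerXn2r ?nnegrE ?expR_ge0 //.
apply: le_trans (@expR_le_inv R (1 / 5) _) _; first by lra.
by have -> : 1 - 1 / 5 = 4 / 5 :> R; [lra | rewrite invf_div].
Qed.

(** The least [n] with [m * (1 - p) ^+ n <= 1] works: what rounding up to an integer adds to
    [p * n%:R] is regained in [m * (1 - p) ^+ n], which drops below 1. *)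
Lemma geometric_threshold (R : realType) (p m : R) :
  0 < p -> p <= 1 -> 1 < m ->
  exists n, m * (1 - p) ^+ n <= 1 /\
    p * n%:R + m * (1 - p) ^+ n <= 1 + ln m.
Proof.
move=> p0 p1 m1.
have geom n : (1 - p) ^+ n <= expR (- (p * n%:R)).
  rewrite -mulNr expRM_natr lerXn2r ?nnegrE ?expR_ge0 //; first by lra.
  exact: expR_ge1Dx.
have ex_n : exists n, m * (1 - p) ^+ n <= 1.
  exists (Num.truncn (ln m / p)).+1.
  have m0 : 0 < m by lra.
  rewrite mulrC -ler_pdivlMr // div1r; apply: le_trans (geom _) _.
  rewrite -[leRHS]lnK ?posrE ?invr_gt0 // ler_expR lnV // lerN2.
  by rewrite mulrC -ler_pdivrMr //; apply/ltW/truncnS_gt.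
case: (ex_minnP ex_n) => n le1 min_n; exists n; split=> //.
case: n le1 min_n => [|n] le1 min_n; first by move: le1; rewrite expr0; lra.
set v := m * (1 - p) ^+ n.
have v1 : 1 < v.
  by rewrite ltNge; apply/negP => /min_n; rewrite ltnn.
have vS : m * (1 - p) ^+ n.+1 = v * (1 - p) by rewrite /v exprS; ring.
rewrite vS in le1 *.
have lnv : ln v <= ln m - p * n%:R.
  rewrite lerBrDr -ler_expR expRD !lnK ?posrE; [|lra..].
  have := geom n; rewrite expRN => h.
  have e0 := expR_gt0 (p * n%:R).
  rewrite -ler_pdivlMr // /v ler_pM2l //; lra.
have lnv' : 1 - v^-1 <= ln v.
  rewrite -[leRHS]opprK -lnV ?posrE; last lra.
  have := @le_ln1Dx R (v^-1 - 1); rewrite [1 + _]addrC subrK.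
  suff /[swap] /[apply] : - 1 < v^-1 - 1 by lra.
  have : 0 < v^-1 by rewrite invr_gt0; lra.
  by lra.
have iv : v * v^-1 = 1 by rewrite divff //; lra.
have iv0 : 0 < v^-1 by rewrite invr_gt0; lra.
(* Hence [p + v * (1 - p) - 1 = (v - 1) * (1 - p) <= 1 - v^-1 <= ln v], and [lnv] concludes. *)
have : 1 - p <= v^-1 by rewrite -ler_pdivlMl ?div1r in le1 *; lra.
rewrite -natr1; nra.
Qed.

(** * Exponentially weighted sums, split at a time threshold *)

Section ThresholdSum.
Context {R : realType}.
(** In the application [c k] is E[d(X_T, Y_T); T = k], [r k] is Pr(T > k), [m] bounds D_2 and [u] is
    exp(gamma). Since [0.-1 = 0], the hypothesis [cr] forces [c 0 = 0]. *)
Variables (p m alpha u : R) (c r : nat -> R) (t0 : nat).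
Hypotheses (p1 : p <= 1) (u1 : 1 <= u) (x1 : u * (1 - p) < 1) (m0 : 0 <= m).
Hypotheses (c0 : forall k, 0 <= c k)
  (cr : forall k, c k <= m * (r k.-1 - r k))
  (ca : forall n, \sum_(k < n) c k <= alpha)
  (r0 : forall k, 0 <= r k) (rp : forall k, r k <= (1 - p) ^+ k).

(* Abel summation: the increments of [u ^+ maxn k t0] are tested against the
   tail [r k], whose geometric decay beats the growth of [u]. *)
Lemma tail_sum n :
  \sum_(k < n.+1) (r k.-1 - r k) * (u ^+ maxn k t0 - u ^+ t0)
    <= (u - 1) * (u * (1 - p)) ^+ t0 / (1 - u * (1 - p)).
Proof.
set x := u * (1 - p).
have x0 : 0 <= x by rewrite mulr_ge0 ?subr_ge0 // (le_trans ler01).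
have x1' : x < 1 by [].
have pos k : 0 <= (u - 1) * x ^+ k / (1 - x).
  by rewrite divr_ge0 ?mulr_ge0 ?exprn_ge0 ?subr_ge0 // ltW.
(* Adding the boundary term of the summation by parts and the rest of the geometric series gives a
   quantity that does not increase with [n], which makes the induction possible. *)
suff H : \sum_(k < n.+1) (r k.-1 - r k) * (u ^+ maxn k t0 - u ^+ t0)
     + r n * (u ^+ maxn n t0 - u ^+ t0) + (u - 1) * x ^+ maxn n t0 / (1 - x)
   <= (u - 1) * x ^+ t0 / (1 - x).
  have := pos (maxn n t0).
  have : 0 <= r n * (u ^+ maxn n t0 - u ^+ t0).
    by rewrite mulr_ge0 // subr_ge0 ler_weXn2l // leq_maxr.
  by lra.
elim: n => [|n IH].
  by rewrite big_ord1 max0n !subrr !(mulr0, mul0r) !add0r.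
rewrite big_ord_recr /=; apply: le_trans IH.
suff : r n * (u ^+ maxn n.+1 t0 - u ^+ maxn n t0)
    + (u - 1) * x ^+ maxn n.+1 t0 / (1 - x) <= (u - 1) * x ^+ maxn n t0 / (1 - x).
  by lra.
have [lt_nt|le_tn] := ltnP n t0.
  by rewrite !(maxn_idPr _) ?(ltnW lt_nt) // subrr mulr0 add0r.
rewrite !(maxn_idPl _) ?(leqW le_tn) //.
have -> : u ^+ n.+1 - u ^+ n = u ^+ n * (u - 1) by rewrite exprS; ring.
have -> : (u - 1) * x ^+ n / (1 - x) =
    (u - 1) * x ^+ n + (u - 1) * x ^+ n.+1 / (1 - x).
  by rewrite exprS; field; rewrite subr_eq0 gt_eqF.
rewrite lerD2r /x exprMn.
have -> : (u - 1) * (u ^+ n * (1 - p) ^+ n) = (1 - p) ^+ n * (u ^+ n * (u - 1)).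
  by ring.
by rewrite ler_wpM2r // mulr_ge0 ?exprn_ge0 ?subr_ge0 // (le_trans ler01).
Qed.

(** Up to [t0] the weight is at most [u ^+ t0] and the total mass [alpha] is enough; the excess of
    the weight past [t0] is controlled by [cr] and [tail_sum]. *)
Lemma threshold_sum n :
  \sum_(k < n.+1) c k * u ^+ k
    <= u ^+ t0 * (alpha + m * (1 - p) ^+ t0 * ((u - 1) / (1 - u * (1 - p)))).
Proof.
apply: (@le_trans _ _ (u ^+ t0 * \sum_(k < n.+1) c k +
    m * \sum_(k < n.+1) (r k.-1 - r k) * (u ^+ maxn k t0 - u ^+ t0))).
  rewrite !mulr_sumr -big_split; apply: ler_sum => k _ /=.
  have h0 : 0 <= u ^+ maxn k t0 - u ^+ t0.
    by rewrite subr_ge0 ler_weXn2l // leq_maxr.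
  have hk : u ^+ k <= u ^+ maxn k t0 by rewrite ler_weXn2l // leq_maxl.
  rewrite mulrA; have := ler_wpM2r h0 (cr k).
  have := ler_wpM2l (c0 k) hk.
  by lra.
have u0 : 0 <= u ^+ t0 by rewrite exprn_ge0 // (le_trans ler01).
have := ler_wpM2l u0 (ca n.+1); have := ler_wpM2l m0 (tail_sum n).
rewrite exprMn; lra.
Qed.

End ThresholdSum.

(** The numerical inequality that closes [weighted_sum_bound], with [delta = 1 - alpha] and
    [y = g * b]. The gap decreases in [y], so the worst case is [y = 5 / 24 * delta]; there it
    equals [k * delta * (1 / 6 - 23 / 192 * delta)]. *)
Lemma threshold_rational (R : realFieldType) (delta y k : R) :
  0 <= delta -> delta <= 1 -> 0 <= y -> y <= 5 / 24 * delta ->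
  k * (1 - 5 / 24 * delta) = 1 ->
  1 - delta + k * y <= (1 - delta / 3 + y) * (1 - k * delta / 2).
Proof.
move=> d0 d1 y0 y1 kE.
have k1 : 1 <= k by nra.
suff H : 1 - delta + k * (5 / 24 * delta) <=
    (1 - delta / 3 + 5 / 24 * delta) * (1 - k * delta / 2).
  have : 0 <= (5 / 24 * delta - y) * (k - 1 + k * delta / 2).
    by rewrite mulr_ge0 ?subr_ge0 //; nra.
  by lra.
have -> : k * (5 / 24 * delta) = k - 1 by lra.
set w := 1 - 5 / 24 * delta in kE.
have w0 : 0 < w by rewrite /w; lra.
have -> : k = w^-1 by rewrite -[LHS](mulfK (lt0r_neq0 w0)) kE mul1r.
rewrite -subr_ge0.
have -> : (1 - delta / 3 + 5 / 24 * delta) * (1 - w^-1 * delta / 2) - (1 - delta + (w^-1 - 1)) =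
  w^-1 * ((1 - delta / 3 + 5 / 24 * delta) * (w - delta / 2) - (1 - delta * w)).
  by field; lra.
rewrite mulr_ge0 ?invr_ge0 ?(ltW w0) // /w.
have : 0 <= delta * (1 / 6 - 23 / 192 * delta) by rewrite mulr_ge0 //; lra.
by lra.
Qed.

(** This is gamma, with [1 + ln m] in place of ln(e m). The parameter [m] is an upper bound for D_2
    rather than D_2 itself, so that it can be taken at least 2. *)
Definition contraction_rate {R : realType} (p alpha m : R) : R :=
  p * (1 - alpha) / (3 * (1 + ln m)).

(** * The supersolution of the renewal inequality *)

Section Renewal.
Context {R : realType}.
Implicit Types (p m alpha : R) (c r : nat -> R).

Lemma contraction_rate_gt0 p alpha m :
  0 < p -> alpha < 1 -> 1 <= m -> 0 < contraction_rate p alpha m.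
Proof.
move=> p0 a1 m1; have lnm : 0 <= ln m by rewrite ln_ge0.
by rewrite divr_gt0 ?mulr_gt0 ?subr_gt0 //; lra.
Qed.

(** From [ln m >= ln 2 >= 3 / 5] one gets [3 * (1 + ln m) >= 24 / 5], whence the constant 5/24. *)
Lemma contraction_rate_small p alpha m :
  0 < p -> alpha < 1 -> 2 <= m ->
  contraction_rate p alpha m / p <= 5 / 24 * (1 - alpha).
Proof.
move=> p0 a1 m2.
have lnm : 3 / 5 <= ln m.
  by apply: (le_trans (ln2_ge R)); rewrite ler_ln ?posrE //; lra.
have -> : contraction_rate p alpha m / p = (1 - alpha) / (3 * (1 + ln m)).
  by rewrite /contraction_rate; field; apply/andP; split; lra.
rewrite ler_pdivrMr; nra.
Qed.

(** [threshold_sum] is applied with [t0] from [geometric_threshold]; all factors are then bounded in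
    terms of [g = gamma / p] and [b = m * (1 - p) ^+ t0]. *)
Lemma weighted_sum_bound p m alpha c r n :
  0 < p -> p <= 1 -> 2 <= m -> 0 <= alpha -> alpha < 1 ->
  (forall k, 0 <= c k) -> (forall k, c k <= m * (r k.-1 - r k)) ->
  (forall n, \sum_(k < n) c k <= alpha) ->
  (forall k, 0 <= r k) -> (forall k, r k <= (1 - p) ^+ k) ->
  \sum_(k < n.+1) c k * expR (contraction_rate p alpha m * k%:R)
    <= 1 - expR (contraction_rate p alpha m) * (1 - alpha) / 2.
Proof.
move=> p0 p1 m2 a0 a1 c0 cr ca r0 rp; set gamma := contraction_rate p alpha m.
have g0 : 0 < gamma by apply: contraction_rate_gt0 => //; lra.
have gs : gamma / p <= _ := contraction_rate_small p0 a1 m2.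
have [t0 [b1 tb]] := @geometric_threshold R p m p0 p1 (ltac:(lra)).
set b := m * (1 - p) ^+ t0 in b1 tb.
have b0 : 0 <= b by rewrite mulr_ge0 ?exprn_ge0; lra.
set g := gamma / p in gs; set u := expR gamma.
have gE : gamma = g * p by rewrite /g divfK //; lra.
have gg0 : 0 < g by rewrite divr_gt0.
have u1 : 1 <= u by rewrite -[leLHS]expR0 ler_expR ltW.
have uV : u <= (1 - gamma)^-1 by apply: expR_le_inv; rewrite gE; nra.
have uV' : u * (1 - gamma) <= 1 by rewrite -ler_pdivlMr ?div1r //; nra.
have x1 : u * (1 - p) < 1 by nra.
have := @threshold_sum R p m alpha u c r t0 p1 u1 x1 (ltac:(lra)) c0 cr ca r0 rp n.
under eq_bigr do rewrite -expRM_natr.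
move=> /le_trans; apply.
(* The left side increases with [u], and equality holds at [u = (1 - g * p)^-1], the upper bound
   [uV]. *)
have fracle : (u - 1) / (1 - u * (1 - p)) <= g / (1 - g).
  rewrite ler_pdivrMr; last lra.
  rewrite mulrAC ler_pdivlMr; last nra.
  move: uV'; rewrite gE; nra.
have dE : (1 - alpha) / 3 = g * (1 + ln m).
  have lnm : 3 / 5 <= ln m.
    by apply: (le_trans (ln2_ge R)); rewrite ler_ln ?posrE //; lra.
  by rewrite /g /gamma /contraction_rate; field; apply/andP; split; lra.
have y0 : 0 <= g * b by rewrite mulr_ge0 // ltW.
have yg : g * b <= g by rewrite ler_piMr // ltW.
(* By [tb] and [dE], [gamma * t0%:R = g * (p * t0%:R) <= (1 - alpha) / 3 - g * b]. *)
have ut0 : u ^+ t0 <= (1 - (1 - alpha) / 3 + g * b)^-1.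
  rewrite /u -expRM_natr.
  have -> : 1 - (1 - alpha) / 3 + g * b = 1 - ((1 - alpha) / 3 - g * b) by ring.
  apply: le_trans (expR_le_inv _); last lra.
  by rewrite ler_expR dE gE -mulrBr -mulrA ler_pM2l //; lra.
(* One constant [k] dominates both [u] and [(1 - g)^-1], because
   [gamma <= g <= 5 / 24 * (1 - alpha)]. *)
set k := (1 - 5 / 24 * (1 - alpha))^-1.
have kE : k * (1 - 5 / 24 * (1 - alpha)) = 1 by rewrite mulVf //; lra.
have gk : (1 - g)^-1 <= k by rewrite lef_pV2 ?posrE; lra.
have uk : u <= k.
  apply: le_trans uV (le_trans _ gk); rewrite lef_pV2 ?posrE; nra.
have := @threshold_rational R (1 - alpha) (g * b) k
  (ltac:(lra)) (ltac:(lra)) y0 (ltac:(lra)) kE.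
rewrite subKr => rat.
apply: (@le_trans _ _ ((1 - (1 - alpha) / 3 + g * b)^-1 * (alpha + k * (g * b)))).
  apply: ler_pM => //; first by rewrite exprn_ge0 //; lra.
    rewrite addr_ge0 // mulr_ge0 // divr_ge0; lra.
  rewrite lerD2l; apply: le_trans (ler_wpM2l b0 fracle) _.
  by have -> : b * (g / (1 - g)) = (1 - g)^-1 * (g * b); [ring | rewrite ler_wpM2r].
apply: (@le_trans _ _ (1 - k * (1 - alpha) / 2)).
  by rewrite ler_pdivrMl //; lra.
rewrite lerD2l lerN2 -!mulrA ler_wpM2r //; lra.
Qed.

(** The factor [2 / (1 - alpha)] is chosen so that the slack left by [weighted_sum_bound] is exactly
    [expR (- gamma * n%:R)], which dominates [r n] because [gamma <= p]. *)
Lemma renewal_bound p m alpha c r n :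
  0 < p -> p <= 1 -> 2 <= m -> 0 <= alpha -> alpha < 1 ->
  (forall k, 0 <= c k) -> (forall k, c k <= m * (r k.-1 - r k)) ->
  (forall n, \sum_(k < n) c k <= alpha) ->
  (forall k, 0 <= r k) -> (forall k, r k <= (1 - p) ^+ k) ->
  r n + \sum_(k < n.+1) c k *
      (2 / (1 - alpha) * expR (- contraction_rate p alpha m * (n - k).+1%:R))
    <= 2 / (1 - alpha) * expR (- contraction_rate p alpha m * n.+1%:R).
Proof.
move=> p0 p1 m2 a0 a1 c0 cr ca r0 rp; set gamma := contraction_rate p alpha m.
have gs : gamma / p <= _ := contraction_rate_small p0 a1 m2.
have da : 0 < 1 - alpha by rewrite subr_gt0.
set C := 2 / (1 - alpha).
have C0 : 0 < C by rewrite divr_gt0.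
have rn : r n <= expR (- gamma * n%:R).
  rewrite expRM_natr; apply: le_trans (rp n) _.
  rewrite lerXn2r ?nnegrE ?expR_ge0 ?subr_ge0 //.
  apply: le_trans (expR_ge1Dx _); rewrite lerD2l lerN2.
  by move: gs; rewrite ler_pdivrMr //; nra.
have e1 : expR (- gamma * n%:R) = expR gamma * expR (- gamma * n.+1%:R).
  by rewrite -expRD -natr1; congr expR; ring.
have -> : \sum_(k < n.+1) c k * (C * expR (- gamma * (n - k).+1%:R)) =
    C * expR (- gamma * n.+1%:R) * \sum_(k < n.+1) c k * expR (gamma * k%:R).
  rewrite mulr_sumr; apply: eq_bigr => k _.
  have -> : expR (- gamma * (n - k).+1%:R) =
      expR (- gamma * n.+1%:R) * expR (gamma * k%:R).
    rewrite -expRD -subSn -1?ltnS // natrB 1?ltnW //; congr expR; ring.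
  by ring.
have w := weighted_sum_bound n p0 p1 m2 a0 a1 c0 cr ca r0 rp.
have E0 := expR_gt0 (- gamma * n.+1%:R).
have CE0 : 0 <= C * expR (- gamma * n.+1%:R) by rewrite mulr_ge0 ?ltW.
have := ler_wpM2l CE0 w.
have : C * expR (- gamma * n.+1%:R) * (expR gamma * (1 - alpha) / 2) =
   expR (- gamma * n%:R).
  by rewrite e1 /C; field; lra.
by lra.
Qed.
End Renewal.

(** * Law of a finite chain stopped on leaving a set *)

Section StoppedLaw.
Context {R : realType} {E : finType}.
Variables (S : pred E) (Q : E -> E -> R) (z0 : E).

(* Sub-probability law of [Z_k] on the event that [Z_i] lies in [S] for all
   [i < k]; outside [S] it is thus the law of the stopped state at time [k]. *)
Fixpoint stopped_law (k : nat) (z : E) : R :=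
  if k is k'.+1 then \sum_(y | S y) stopped_law k' y * Q y z
  else (z == z0)%:R.

Lemma stopped_law_ge0 k z :
  (forall y w, S y -> 0 <= Q y w) -> 0 <= stopped_law k z.
Proof.
move=> Q0; elim: k z => [|k IH] z /=; first exact: ler0n.
by apply: sumr_ge0 => y Sy; rewrite mulr_ge0 // Q0.
Qed.

Lemma sum_stopped_lawS k :
  (forall y, S y -> \sum_w Q y w = 1) ->
  \sum_z stopped_law k.+1 z = \sum_(z | S z) stopped_law k z.
Proof.
move=> Q1; rewrite exchange_big; apply: eq_bigr => z Sz /=.
by rewrite -mulr_sumr Q1 // mulr1.
Qed.

(** Optional stopping at the minimum of [n] and the exit time: each step expands [psi] over the mass
    still in [S], while mass that has left keeps its remaining horizon. *)
Lemma stopped_decomposition (psi : nat -> E -> R) n t :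
  (forall k z, S z -> psi k.+1 z = \sum_w Q z w * psi k w) ->
  psi (n + t)%N z0 =
    \sum_(k < n) \sum_(z | ~~ S z) stopped_law k z * psi (n + t - k)%N z
    + \sum_z stopped_law n z * psi t z.
Proof.
move=> psiS; elim: n t => [|n IH] t.
  rewrite big_ord0 add0r (bigD1 z0) //= eqxx mul1r big1 ?addr0 // => z /negPf ->.
  by rewrite mul0r.
rewrite addSnnS IH big_ord_recr /= -addrA; congr (_ + _).
rewrite (bigID S) /= addrC addKn; congr (_ + _).
under eq_bigr => z Sz do rewrite psiS // mulr_sumr.
rewrite exchange_big; apply: eq_bigr => w _ /=.
by rewrite mulr_suml; apply: eq_bigr => y _; rewrite mulrA.
Qed.

End StoppedLaw.

(** * Couplings and the contraction of expectations *)

Section Contraction.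
Context {R : realType} {Omega : finType}.
Variables (d : Omega -> Omega -> nat) (P : Omega -> Omega -> R)
  (Q : Omega * Omega -> Omega * Omega -> R).

(** A geodesic between adjacent states has a single edge, along which the composition returns the
    assigned coupling. *)
Lemma path_coupling_unit_pair x y :
  is_path_coupling d P Q -> unit_pair d x y ->
  is_coupling (P x) (P y) (Q (x, y)).
Proof.
move=> [q [cq qQ]] xy; have [s [[ps ls ss] Qs]] := qQ x y.
have {}ss : size s = 1%N by rewrite ss; apply/eqP.
case: s ss ps ls Qs => [//|z [|//]] _ /= _ -> QE {z}.
have [q0 qx qy] := cq x y xy.
suff -> : Q (x, y) = q x y by [].
apply/funext => -[a b]; rewrite QE /= (bigD1 b) //= eqxx mulr1 big1 => [|z zb]; last first.
  by rewrite (negPf zb) !mulr0.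
(* If [P y b = 0] the quotient is 0 by convention, and so is [q x y (a, b)], being at most its
   second marginal at [b]. *)
rewrite addr0; have [Pb|Pb] := eqVneq (P y b) 0; last by rewrite divfK.
rewrite Pb mulr0; apply/esym/eqP; rewrite eq_le q0 andbT -Pb -qy.
by rewrite (bigD1 a) //= lerDl sumr_ge0.
Qed.

Lemma lipschitz_geodesic (f : Omega -> R) (b : R) x y :
  is_path_metric d ->
  (forall x y, unit_pair d x y -> `|f x - f y| <= b) ->
  `|f x - f y| <= (d x y)%:R * b.
Proof.
move=> [_ geo] fb; have [s [ps ls ss]] := geo x y; rewrite -ss.
elim: s x ps ls {ss geo} => [|z s IH] x /= ps ls.
  by rewrite ls subrr normr0 mul0r.
case/andP: ps => xz ps.
rewrite -(subrKA (f z)) (le_trans (ler_normD _ _)) //.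
by rewrite -nat1r mulrDl mul1r lerD // ?fb // IH.
Qed.

Definition expect_after n (phi : Omega -> R) x : R := \sum_y tpow P n x y * phi y.

Lemma expect_afterS n phi x :
  expect_after n.+1 phi x = \sum_z P x z * expect_after n phi z.
Proof.
under [RHS]eq_bigr do rewrite mulr_sumr.
rewrite exchange_big /=; apply: eq_bigr => y _.
by rewrite mulr_suml; apply: eq_bigr => z _; rewrite mulrA.
Qed.

Let S : pred (Omega * Omega) := fun z => unit_pair d z.1 z.2.

Lemma coupling_sum (mu nu f : Omega -> R) (J : Omega * Omega -> R) :
  is_coupling mu nu J ->
  \sum_w J w * (f w.1 - f w.2) = \sum_x mu x * f x - \sum_x nu x * f x.
Proof.
move=> [_ Jmu Jnu].
under eq_bigr do rewrite mulrBr.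
rewrite sumrB; congr (_ - _).
  under [RHS]eq_bigr do rewrite -Jmu mulr_suml.
  by rewrite pair_big; apply: eq_bigr => -[].
under [RHS]eq_bigr do rewrite -Jnu mulr_suml.
by rewrite exchange_big pair_big; apply: eq_bigr => -[].
Qed.

(* [|E_x phi(X_n) - E_y phi(X_n)|] is subadditive along paths for a fixed [phi],
   which spares the analysis of the composed coupling of distant pairs. *)
Lemma lipschitz_decay (beta : nat -> R) (phi : Omega -> R) :
  is_path_metric d ->
  (forall x y, unit_pair d x y -> is_coupling (P x) (P y) (Q (x, y))) ->
  (forall n, 0 <= beta n) ->
  (forall z0 n, S z0 ->
     \sum_(z | S z) stopped_law S Q z0 n z
     + \sum_(k < n.+1)
         (\sum_(z | ~~ S z) stopped_law S Q z0 k z * (d z.1 z.2)%:R)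
           * beta (n - k)%N <= beta n) ->
  (forall x y, `|phi x - phi y| <= (d x y)%:R) ->
  forall n x y,
    `|expect_after n phi x - expect_after n phi y| <= (d x y)%:R * beta n.
Proof.
move=> dP cQ beta0 ren lip; elim/ltn_ind => n IH x y.
apply: lipschitz_geodesic => // {}x {}y xy.
have Q0 z w : S z -> 0 <= Q z w by case: z => a b /cQ [].
pose psi k (z : Omega * Omega) := expect_after k phi z.1 - expect_after k phi z.2.
have psiS k z : S z -> psi k.+1 z = \sum_w Q z w * psi k w.
  case: z => a b ab; rewrite /psi !expect_afterS /=.
  by rewrite -(coupling_sum _ (cQ _ _ ab)).
have psi0 z : `|psi 0%N z| <= (d z.1 z.2)%:R.
  suff E0 a : expect_after 0 phi a = phi a by rewrite /psi !E0.
  rewrite /expect_after (bigD1 a) //= eqxx mul1r big1 ?addr0 // => b ba.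
  by rewrite eq_sym (negPf ba) mul0r.
rewrite -[X in `|X|]/(psi n (x, y)).
have := stopped_decomposition (x, y) n 0 psiS; rewrite addn0 => ->.
set g := stopped_law S Q (x, y); have g0 k z : 0 <= g k z by exact: stopped_law_ge0.
apply: le_trans (ren (x, y) n xy).
(* The mass that leaves exactly at time [n] is moved into the exit sum, to match the form of
   [ren]. *)
have -> : \sum_(k < n) \sum_(z | ~~ S z) g k z * psi (n - k)%N z
      + \sum_z g n z * psi 0%N z =
    \sum_(z | S z) g n z * psi 0%N z
      + \sum_(k < n.+1) \sum_(z | ~~ S z) g k z * psi (n - k)%N z.
  by rewrite big_ord_recr /= subnn [X in _ + X = _](bigID S) /= addrCA.
rewrite (le_trans (ler_normD _ _)) // lerD //.
  apply: le_trans (ler_norm_sum _ _ _) _; apply: ler_sum => z Sz.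
  by rewrite normrM ger0_norm // ler_piMr // (le_trans (psi0 z)) // (eqP Sz).
apply: le_trans (ler_norm_sum _ _ _) _; apply: ler_sum => k _.
apply: le_trans (ler_norm_sum _ _ _) _; rewrite mulr_suml; apply: ler_sum => z Sz.
rewrite normrM ger0_norm // -mulrA.
(* The induction hypothesis covers horizons [n - k < n] only; for [k = 0] there is no exit mass,
   since the initial pair is adjacent. *)
have [k0|k0] := posnP k; last first.
  by rewrite ler_wpM2l // IH // ltn_subrL k0 (leq_trans k0) // -ltnS.
rewrite k0 /g /=; have -> : (z == (x, y)) = false.
  by apply/negP => /eqP zE; move: Sz; rewrite zE /S xy.
by rewrite !mul0r.
Qed.

(** By stationarity the [pi]-average of [expect_after n phi] is that of [phi], so for [phi] half the
    sign of the difference the distance is a [pi]-average of differences of expectations. This [phi]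
    oscillates by at most 1, hence is 1-Lipschitz for an integer-valued metric. *)
Lemma tv_dist_le (pi : Omega -> R) (b : R) n :
  is_transition P -> is_stationary P pi -> is_metric d ->
  (forall phi : Omega -> R, (forall x y, `|phi x - phi y| <= (d x y)%:R) ->
     forall x y, `|expect_after n phi x - expect_after n phi y| <= b) ->
  forall x, tv_dist (tpow P n x) pi <= b.
Proof.
move=> tP [[pi0 pi1] piP] [d0 _ _] contr x.
have piE k phi : \sum_y pi y * expect_after k phi y = \sum_y pi y * phi y.
  elim: k => [|k IH].
    apply: eq_bigr => y _; rewrite /expect_after (bigD1 y) //= eqxx mul1r.
    by rewrite big1 ?addr0 // => z zy; rewrite eq_sym (negPf zy) mul0r.
  under eq_bigr do rewrite expect_afterS mulr_sumr.
  rewrite exchange_big /= -IH; apply: eq_bigr => z _.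
  by rewrite -[in RHS]piP mulr_suml; apply: eq_bigr => y _; rewrite mulrA.
pose phi z := 2^-1 * Num.sg (tpow P n x z - pi z).
have lip u v : `|phi u - phi v| <= (d u v)%:R.
  have [->|uv] := eqVneq u v; first by rewrite subrr normr0.
  apply: (@le_trans _ _ 1); last first.
    by rewrite ler1n lt0n; apply: contra uv => /eqP/d0 ->.
  rewrite -mulrBr normrM ger0_norm // ler_pdivrMl // mulr1.
  apply: le_trans (ler_normB _ _) _; rewrite !normr_sg.
  by case: eqP; case: eqP => //= _ _; lra.
have -> : tv_dist (tpow P n x) pi =
    \sum_y pi y * (expect_after n phi x - expect_after n phi y).
  under eq_bigr do rewrite mulrBr.
  rewrite sumrB -mulr_suml pi1 mul1r piE /expect_after -sumrB /tv_dist mulr_sumr.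
  apply: eq_bigr => z _; rewrite -mulrBl /phi normrEsg; ring.
apply: (@le_trans _ _ (\sum_y pi y * b)); last by rewrite -mulr_suml pi1 mul1r.
apply: ler_sum => y _; rewrite ler_wpM2l //.
exact: le_trans (ler_norm _) (contr phi lip x y).
Qed.

End Contraction.

(** * Measurability and probabilities for finite-valued processes *)

Section FiniteValuedProcess.
Context {R : realType} {E : finType} {disp : measure_display}
  {W : measurableType disp}.
Variables (Pr : probability W R) (Z : nat -> W -> E).
Hypothesis mZ : forall t z, measurable [set w | Z t w = z].

Lemma measurable_state t (A : pred E) : measurable [set w | A (Z t w)].
Proof.
have -> : [set w | A (Z t w)] = \bigcup_(z in [set` A]) [set w | Z t w = z].
  by apply/seteqP; split=> w /=; [exists (Z t w) | case=> z Az ->].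
by apply: fin_bigcup_measurable => //; exact: finite_finset.
Qed.

Lemma measurable_path n (A : nat -> pred E) :
  measurable [set w | forall i, (i < n)%N -> A i (Z i w)].
Proof.
have -> : [set w | forall i, (i < n)%N -> A i (Z i w)] =
    \bigcap_(i in `I_n) [set w | A i (Z i w)].
  by apply/seteqP; split=> w /= Aw i; exact: Aw.
by apply: bigcap_measurableType => i _; exact: measurable_state.
Qed.

Lemma prob_state_sum (B : set W) t (A : pred E) :
  measurable B ->
  Pr (B `&` [set w | A (Z t w)]) =
    (\sum_(z | A z) Pr (B `&` [set w | Z t w = z]))%E.
Proof.
move=> mB.
have -> : B `&` [set w | A (Z t w)] =
    \bigcup_(z in [set` A]) (B `&` [set w | Z t w = z]).
  apply/seteqP; split=> w /=; last by case=> z Az [Bw ->].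
  by case=> Bw Aw; exists (Z t w).
rewrite measure_fin_bigcup.
- by apply/esym/bigfs => [|i _]; rewrite ?index_enum_uniq ?mem_index_enum.
- exact: finite_finset.
- by move=> x y _ _ [w [[_ <-] [_ <-]]].
- by move=> z _; apply: measurableI.
Qed.

Lemma sum_prob_le_expectation (I : finType) (A : I -> set W) (a : I -> R)
    (X : W -> R) :
  (forall i, measurable (A i)) -> (forall i, 0 <= a i) ->
  measurable_fun setT X ->
  (forall w, \sum_i a i * \1_(A i) w <= X w) ->
  (\sum_i (a i)%:E * Pr (A i) <= 'E_Pr [X])%E.
Proof.
move=> mA a0 mX AX.
have -> : ('E_Pr [X] = \int[Pr]_w (X w)%:E)%E by rewrite unlock.
pose f i : W -> \bar R := fun w => (a i * \1_(A i) w)%:E.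
have f0 i w : (0 <= f i w)%E by rewrite lee_fin mulr_ge0.
have mf i : measurable_fun [set: W] (f i).
  by apply/measurable_EFinP/measurable_funM => //; exact: measurable_indic.
apply: (@le_trans _ _ (\int[Pr]_w (\sum_i f i w))%E).
  rewrite ge0_integral_sum //; apply: lee_sum => i _.
  under eq_integral do rewrite /f EFinM.
  rewrite ge0_integralZl_EFin ?integral_indic ?setIT //.
  exact/measurable_EFinP/measurable_indic.
apply: ge0_le_integral => //.
- by move=> w _; rewrite sume_ge0.
- exact: emeasurable_sum.
- exact/measurable_EFinP.
- by move=> w _; rewrite sumEFin lee_fin.
Qed.

End FiniteValuedProcess.

(** * The stopped law as a probability of path events *)

Section MarkovStopping.
Context {R : realType} {E : finType} {disp : measure_display}
  {W : measurableType disp}.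
Variables (S : pred E) (Q : E -> E -> R) (Pr : probability W R)
  (Z : nat -> W -> E) (z0 : E).
Hypothesis chain : is_markov_chain Q Pr Z z0.

(** The finite-dimensional laws fix whole paths. Keeping the values from time [k] to [n] prescribed
    lets the earlier coordinates be summed over [S] one at a time, by induction on [k]. *)
Lemma prob_stopped_path k n (s : nat -> E) : (k <= n)%N ->
  Pr [set w | forall i, (i < n.+1)%N -> if (i < k)%N then S (Z i w) else Z i w == s i]
    = (stopped_law S Q z0 k (s k) * \prod_(k <= i < n) Q (s i) (s i.+1))%:E.
Proof.
have [mZ fdd] := chain.
elim: k s => [|k IH] s kn.
  rewrite big_mkord -fdd; congr (Pr _); apply/seteqP; split=> w /= sw i ltin.
    exact/eqP/sw.
  exact/eqP/sw.
(* Coordinate [k] is left free in [A], so that the event can be split according to the value of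
   [Z k] in [S]. *)
pose A i : pred E := fun z =>
  if (i < k)%N then S z else (i == k) || (z == s i).
have -> : [set w | forall i, (i < n.+1)%N ->
      if (i < k.+1)%N then S (Z i w) else Z i w == s i] =
    [set w | forall i, (i < n.+1)%N -> A i (Z i w)] `&` [set w | S (Z k w)].
  apply/seteqP; split=> w /=.
    move=> sw; split=> [i ltin|]; last by have := sw k; rewrite ltnSn; apply; exact: leqW.
    have := sw i ltin; rewrite /A ltnS leq_eqVlt.
    by case: eqP => //= ik; case: ltnP.
  case=> Aw Sw i ltin; rewrite ltnS leq_eqVlt.
  have [->//|ik] := eqVneq i k.
  by have := Aw i ltin; rewrite /A (negPf ik).
rewrite (prob_state_sum Pr mZ k S (measurable_path mZ n.+1 A)).
rewrite /= mulr_suml -sumEFin; apply: eq_bigr => z Sz.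
pose s' i := if i == k then z else s i.
have -> : [set w | forall i, (i < n.+1)%N -> A i (Z i w)] `&` [set w | Z k w = z] =
   [set w | forall i, (i < n.+1)%N -> if (i < k)%N then S (Z i w) else Z i w == s' i].
  apply/seteqP; split=> w /=.
    case=> Aw Zw i ltin; have := Aw i ltin; rewrite /A /s'; case: ltnP => // _.
    by case: eqP => [->|//]; rewrite Zw.
  move=> sw; split=> [i ltin|].
    by have := sw i ltin; rewrite /A /s'; case: ltnP => // _; case: (i =P k).
  by have := sw k (leqW kn); rewrite ltnn /s' eqxx => /eqP.
rewrite IH ?(ltnW kn) // big_ltn // /s' eqxx (gtn_eqF (ltnSn k)) mulrA.
congr ((_ * _)%:E); apply: eq_big_nat => i /andP[ki _].
by rewrite !gtn_eqF // ltnW.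
Qed.

Lemma prob_stopped k (A : pred E) :
  Pr [set w | (forall i, (i < k)%N -> S (Z i w)) /\ A (Z k w)] =
    (\sum_(z | A z) stopped_law S Q z0 k z)%:E.
Proof.
have [mZ _] := chain.
rewrite (prob_state_sum Pr mZ k A (measurable_path mZ k (fun=> S))).
rewrite -sumEFin; apply: eq_bigr => z Az.
have := @prob_stopped_path k k (fun=> z) (leqnn k).
rewrite big_geq // mulr1 => <-; congr (Pr _).
apply/seteqP; split=> w /=.
  case=> Sw Zw i; rewrite ltnS leq_eqVlt => /orP[/eqP->|ik].
    by rewrite ltnn Zw.
  by rewrite ik Sw.
move=> sw; split=> [i ik|].
  by have := sw i (leqW ik); rewrite ik.
by have := sw k (ltnSn k); rewrite ltnn => /eqP.
Qed.

Lemma measurable_stopped k (A : pred E) :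
  measurable [set w | (forall i, (i < k)%N -> S (Z i w)) /\ A (Z k w)].
Proof.
have [mZ _] := chain.
apply: (@measurableI _ _ [set w | forall i, (i < k)%N -> S (Z i w)]).
  exact: (measurable_path mZ k (fun=> S)).
exact: (measurable_state mZ k A).
Qed.

End MarkovStopping.

(** * The stopping time T and the distance at T *)

Section StopTime.
Context {Omega : finType}.
Variable d : Omega -> Omega -> nat.

Definition adjacent_pair : pred (Omega * Omega) := fun z => unit_pair d z.1 z.2.

Lemma stop_time_Some (z : nat -> Omega * Omega) t :
  stop_time d z = Some t <->
  (forall i, (i < t)%N -> adjacent_pair (z i)) /\ ~~ adjacent_pair (z t).
Proof.
rewrite /stop_time; case: pselect => [ex_t|nex]; last first.
  by split=> // -[_ zt]; case: nex; exists t.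
case: ex_minnP => s zs min_s; split=> [[<-]|[lt_t zt]].
  split=> // i; apply: contraTT => zi; rewrite -leqNgt; exact: min_s.
congr Some; apply/eqP; rewrite eqn_leq min_s // leqNgt.
by apply: contra zs => /lt_t.
Qed.

Lemma stop_time_None (z : nat -> Omega * Omega) :
  stop_time d z = None <-> forall i, adjacent_pair (z i).
Proof.
rewrite /stop_time; case: pselect => [ex_t|nex]; split=> //.
  by case: (ex_t) => t zt /(_ t); rewrite /adjacent_pair /unit_pair (negPf zt).
by move=> _ i; apply/negPn/negP => zi; apply: nex; exists i.
Qed.

Lemma stop_geP (z : nat -> Omega * Omega) t :
  stop_ge d t z <-> forall i, (i < t)%N -> adjacent_pair (z i).
Proof.
rewrite /stop_ge; case zt: (stop_time d z) => [s|]; last first.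
  by split=> // _ i _; move/stop_time_None: zt.
have [lt_s zs] := (stop_time_Some z s).1 zt; split=> [ts i it|adj].
  exact: lt_s (leq_trans it ts).
by rewrite leqNgt; apply: contra zs => /adj.
Qed.

Lemma stop_dist_Some (z : nat -> Omega * Omega) t :
  stop_time d z = Some t -> stop_dist d z = d (z t).1 (z t).2.
Proof. by rewrite /stop_dist => ->. Qed.

Lemma stop_dist_neq1 (z : nat -> Omega * Omega) : stop_dist d z != 1%N.
Proof.
rewrite /stop_dist; case zt: (stop_time d z) => [s|//].
by have [_] := (stop_time_Some z s).1 zt.
Qed.

Context {R : realType} {disp : measure_display} {W : measurableType disp}.
Variables (Q : Omega * Omega -> Omega * Omega -> R) (Pr : probability W R)
  (Z : nat -> W -> Omega * Omega) (z0 : Omega * Omega).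
Hypothesis chain : is_markov_chain Q Pr Z z0.

Let law := stopped_law adjacent_pair Q z0.

Lemma stop_time_event t :
  [set w | stop_time d (Z ^~ w) = Some t] =
  [set w | (forall i, (i < t)%N -> adjacent_pair (Z i w)) /\ predC adjacent_pair (Z t w)].
Proof. by apply/seteqP; split=> w /=; move/stop_time_Some. Qed.

Lemma stop_ge_event t :
  [set w | stop_ge d t (Z ^~ w)] =
  [set w | (forall i, (i < t)%N -> adjacent_pair (Z i w)) /\ predT (Z t w)].
Proof.
by apply/seteqP; split=> w /=; [move/stop_geP | case=> ? _; apply/stop_geP].
Qed.

(** Clearing the denominator turns the conditional bound into p Pr(T >= t) <= Pr(T = t), which also
    holds when T >= t has probability 0. *)
Lemma stopping_rate p t :
  (forall y w, adjacent_pair y -> 0 <= Q y w) ->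
  ((0 < Pr [set w | stop_ge d t (Z ^~ w)])%E ->
     p <= cond_prob Pr [set w | stop_time d (Z ^~ w) = Some t]
            [set w | stop_ge d t (Z ^~ w)]) ->
  p * \sum_z law t z <= \sum_(z | ~~ adjacent_pair z) law t z.
Proof.
move=> Q0; rewrite /cond_prob.
have -> : [set w | stop_time d (Z ^~ w) = Some t] `&`
    [set w | stop_ge d t (Z ^~ w)] = [set w | stop_time d (Z ^~ w) = Some t].
  apply/setIidPl => w /= /stop_time_Some [adj _]; exact/stop_geP.
rewrite stop_ge_event stop_time_event !(prob_stopped _ chain) /= lte_fin => cond.
have law0 z : 0 <= law t z by exact: stopped_law_ge0.
have : 0 <= \sum_z law t z by exact: sumr_ge0.
rewrite le_eqVlt => /predU1P[<-|pos].
  by rewrite mulr0 sumr_ge0.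
by rewrite -ler_pdivlMr // cond.
Qed.

Lemma measurable_stop_dist k : measurable [set w | stop_dist d (Z ^~ w) = k].
Proof.
pose A t := [set w | (forall i, (i < t)%N -> adjacent_pair (Z i w)) /\
  (fun z => ~~ adjacent_pair z && (d z.1 z.2 == k)) (Z t w)].
have mA t : measurable (A t) by exact: (measurable_stopped _ chain).
(* [B] collects the trajectories that never stop; by convention they count only for the value 0. *)
pose B := [set w | k = 0%N /\ stop_time d (Z ^~ w) = None].
have mB : measurable B.
  have [k0|k0] := eqVneq k 0%N; last first.
    have -> : B = set0 by apply/seteqP; split=> w //= [/eqP]; rewrite (negPf k0).
    exact: measurable0.
  have -> : B = \bigcap_t [set w | (forall i, (i < t)%N -> adjacent_pair (Z i w)) /\
       predT (Z t w)].
    apply/seteqP; split=> w /=.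
      by case=> _ /stop_time_None adj t _; split.
    by move=> adj; split=> //; apply/stop_time_None => i; apply: (adj i.+1 I).1.
  by apply: bigcapT_measurable => t; exact: (measurable_stopped _ chain).
have -> : [set w | stop_dist d (Z ^~ w) = k] = \bigcup_t A t `|` B.
  apply/seteqP; split=> w /=.
    case zt: (stop_time d (Z ^~ w)) => [t|].
      rewrite (stop_dist_Some zt) => dk; left; exists t => //.
      by case/stop_time_Some: zt => adj zt; split=> //=; rewrite zt dk eqxx.
    by rewrite /stop_dist zt; right; split.
  case=> [[t _ [adj /andP[zt /eqP dk]]]|[-> zt]]; last by rewrite /stop_dist zt.
  by rewrite (@stop_dist_Some _ t) //; apply/stop_time_Some.
by apply: measurableU => //; exact: bigcup_measurable.
Qed.

(** Exit states of positive mass thereby enter the maximum that defines D_2. *)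
Lemma stop_dist_attained t z :
  ~~ adjacent_pair z -> 0 < law t z ->
  (0 < Pr [set w | stop_dist d (Z ^~ w) = d z.1 z.2])%E.
Proof.
move=> nz pos.
have : Pr [set w | (forall i, (i < t)%N -> adjacent_pair (Z i w)) /\ pred1 z (Z t w)] =
    (law t z)%:E by rewrite (prob_stopped _ chain) big_pred1_eq.
move=> PE; apply: (@lt_le_trans _ _ (law t z)%:E); first by rewrite lte_fin.
rewrite -PE le_measure // ?inE.
- exact: (measurable_stopped _ chain).
- exact: measurable_stop_dist.
- move=> w /= [adj /eqP Zt]; rewrite (@stop_dist_Some _ t) ?Zt //.
  by apply/stop_time_Some; rewrite Zt.
Qed.

(** The events that T = k and Z_k = z are disjoint, so at each outcome at most one summand is
    nonzero, and that one is the distance at T. *)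
Lemma sum_stop_dist_le n :
  ((\sum_(k < n) \sum_(z | ~~ adjacent_pair z) law k z * (d z.1 z.2)%:R)%:E
    <= 'E_Pr [fun w => (stop_dist d (Z ^~ w))%:R])%E.
Proof.
pose A (i : 'I_n * (Omega * Omega)) := [set w |
  (forall j, (j < i.1)%N -> adjacent_pair (Z j w)) /\ pred1 i.2 (Z i.1 w)].
pose a (i : 'I_n * (Omega * Omega)) : R :=
  if adjacent_pair i.2 then 0 else (d i.2.1 i.2.2)%:R.
have := @sum_prob_le_expectation R _ W Pr _ A a
  (fun w => (stop_dist d (Z ^~ w))%:R).
have -> : (\sum_i (a i)%:E * Pr (A i) =
    (\sum_(k < n) \sum_(z | ~~ adjacent_pair z) law k z * (d z.1 z.2)%:R)%:E)%E.
  under [in RHS]eq_bigr do rewrite big_mkcond.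
  rewrite pair_big /= -sumEFin; apply: eq_bigr => -[k z] _ /=.
  rewrite /A /a (prob_stopped _ chain) big_pred1_eq /= -EFinM.
  by case: adjacent_pair; rewrite ?mul0r // mulrC.
apply.
- by move=> i; exact: (measurable_stopped _ chain).
- by move=> i; rewrite /a; case: ifP.
- move=> _ Y _; rewrite setTI.
  have -> : (fun w => (stop_dist d (Z ^~ w))%:R) @^-1` Y =
     \bigcup_(k in [set k : nat | Y k%:R]) [set w | stop_dist d (Z ^~ w) = k].
    by apply/seteqP; split=> w /=; [exists (stop_dist d (Z ^~ w)) | case=> k Yk ->].
  by apply: bigcup_measurable => k _; exact: measurable_stop_dist.
- move=> w.
  pose f i : R := a i * \1_(A i) w.
  have fN0 i : f i != 0 ->
      stop_time d (Z ^~ w) = Some (i.1 : nat) /\ i.2 = Z i.1 w.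
    rewrite mulf_eq0 negb_or /a indicE => /andP[].
    case: ifP => [_|/negbT ni _]; first by rewrite eqxx.
    case: (boolP (w \in A i)) => [|_]; last by rewrite eqxx.
    rewrite inE => -[adj /eqP iZ] _; split=> //.
    by apply/stop_time_Some; rewrite iZ.
  have [i0 fi0|f0] := pickP (fun i => f i != 0); last first.
    by rewrite big1 ?ler0n // => i _; apply/eqP/negbFE/f0.
  have [st iZ] := fN0 _ fi0.
  rewrite (bigD1 i0) //= big1 ?addr0 => [|i]; last first.
    apply: contraNeq => /fN0 [sti iZi]; apply/eqP.
    move: sti; rewrite st => -[] /val_inj i1.
    by case: i i0 i1 iZ iZi {fi0 st} => k z [k0 z0'] /= <- -> ->.
  rewrite (stop_dist_Some st) -iZ /a indicE.
  by case: ifP => _; case: (_ \in _); rewrite ?mul0r ?mulr1 ?mulr0.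
Qed.

End StopTime.

Lemma leq_diameter (Omega : finType) (d : Omega -> Omega -> nat) x y :
  (d x y <= diameter d)%N.
Proof. exact/(bigop.bigmax_sup x)/(bigop.bigmax_sup y). Qed.

(** * From the stopping hypotheses to a mixing bound *)

Section MixingBound.
Context {R : realType} {Omega : finType} {disp : measure_display}
  {W : measurableType disp}.
Variables (P : Omega -> Omega -> R) (pi : Omega -> R)
  (d : Omega -> Omega -> nat) (Q : Omega * Omega -> Omega * Omega -> R)
  (Pr : Omega * Omega -> probability W R) (Z : nat -> W -> Omega * Omega)
  (p alpha m : R).

Lemma stopped_renewal z0 :
  (forall y w, adjacent_pair d y -> 0 <= Q y w) ->
  (forall y, adjacent_pair d y -> \sum_w Q y w = 1) ->
  adjacent_pair d z0 -> is_markov_chain Q (Pr z0) Z z0 ->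
  0 < p -> alpha < 1 -> 2 <= m ->
  (forall t, (1 <= t)%N -> (0 < Pr z0 [set w | stop_ge d t (Z ^~ w)])%E ->
     p <= cond_prob (Pr z0) [set w | stop_time d (Z ^~ w) = Some t]
            [set w | stop_ge d t (Z ^~ w)]) ->
  ('E_(Pr z0) [fun w => (stop_dist d (Z ^~ w))%:R] <= alpha%:E)%E ->
  (forall z, ~~ adjacent_pair d z ->
     (0 < Pr z0 [set w | stop_dist d (Z ^~ w) = d z.1 z.2])%E ->
     (d z.1 z.2)%:R <= m) ->
  let beta n := 2 / (1 - alpha) * expR (- contraction_rate p alpha m * n.+1%:R) in
  forall n,
    \sum_(z | adjacent_pair d z) stopped_law (adjacent_pair d) Q z0 n z
    + \sum_(k < n.+1)
        (\sum_(z | ~~ adjacent_pair d z)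
           stopped_law (adjacent_pair d) Q z0 k z * (d z.1 z.2)%:R) * beta (n - k)%N
    <= beta n.
Proof.
move=> Q0 Q1 adj0 chain p0 a1 m2 rate Ea dm beta n.
pose g := stopped_law (adjacent_pair d) Q z0.
pose r k := \sum_(z | adjacent_pair d z) g k z.
pose c k := \sum_(z | ~~ adjacent_pair d z) g k z * (d z.1 z.2)%:R.
have g0 k z : 0 <= g k z by exact: stopped_law_ge0.
have r_ge0 k : 0 <= r k by exact: sumr_ge0.
have r0 : r 0%N = 1.
  rewrite /r (bigD1 z0) //= eqxx big1 ?addr0 // => z /andP[_ /negPf ->] //.
have exitE k : \sum_(z | ~~ adjacent_pair d z) g k.+1 z = r k - r k.+1.
  by rewrite /r -(sum_stopped_lawS _ _ Q1) [in RHS](bigID (adjacent_pair d)) /= addrC addrK.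
(* The rate is used at time [k.+1], where Pr(T >= k + 1) is [r k]. *)
have rS k : p * r k <= r k - r k.+1.
  rewrite -exitE /r -(sum_stopped_lawS _ _ Q1).
  by apply: (stopping_rate chain Q0); exact: rate.
have p1 : p <= 1.
  by have := rS 0%N; have := r_ge0 1%N; rewrite r0; lra.
have rp k : r k <= (1 - p) ^+ k.
  elim: k => [|k IH]; first by rewrite r0.
  rewrite exprS; apply: (@le_trans _ _ ((1 - p) * r k)); first by have := rS k; lra.
  by rewrite ler_wpM2l // subr_ge0.
have c0 k : 0 <= c k by apply: sumr_ge0 => z _; rewrite mulr_ge0.
have cr k : c k <= m * (r k.-1 - r k).
  case: k => [|k].
    rewrite subrr mulr0 /c big1 // => z nz; rewrite /g /=.
    by case: eqP => [zE|]; [move: nz; rewrite zE adj0 | rewrite mul0r].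
  rewrite -exitE mulr_sumr; apply: ler_sum => z nz; rewrite mulrC.
  (* The bound [dm] is available for attained distances only, so states of zero mass are treated
     apart. *)
  have := g0 k.+1 z; rewrite le_eqVlt => /predU1P[<-|pos]; first by rewrite !mulr0.
  by rewrite ler_wpM2r // dm //; apply: (stop_dist_attained chain nz pos).
have ca k : \sum_(i < k) c i <= alpha.
  by rewrite -lee_fin; apply: le_trans Ea; exact: sum_stop_dist_le.
have a0 : 0 <= alpha by have := ca 0%N; rewrite big_ord0.
exact: (renewal_bound n p0 p1 m2 a0 a1 c0 cr ca r_ge0 rp).
Qed.

Hypotheses (tP : is_transition P) (stP : is_stationary P pi)
  (dP : is_path_metric d) (cQ : is_path_coupling d P Q)
  (chain : forall x y, unit_pair d x y -> is_markov_chain Q (Pr (x, y)) Z (x, y))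
  (p0 : 0 < p) (a1 : alpha < 1)
  (rate : forall x y, unit_pair d x y -> forall t : nat, (1 <= t)%N ->
     (0 < Pr (x, y) [set w | stop_ge d t (Z ^~ w)])%E ->
     p <= cond_prob (Pr (x, y))
            [set w | stop_time d (Z ^~ w) = Some t]
            [set w | stop_ge d t (Z ^~ w)])
  (contr : forall x y, unit_pair d x y ->
     ('E_(Pr (x, y)) [fun w => (stop_dist d (Z ^~ w))%:R] <= alpha%:E)%E)
  (m2 : 2 <= m) (dm : (max_stop_dist d Pr Z)%:R <= m).

Lemma tv_dist_decay n x :
  tv_dist (tpow P n x) pi <=
    (diameter d)%:R *
      (2 / (1 - alpha) * expR (- contraction_rate p alpha m * n.+1%:R)).
Proof.
have coupl x1 y1 : unit_pair d x1 y1 -> is_coupling (P x1) (P y1) (Q (x1, y1)).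
  exact: path_coupling_unit_pair cQ.
have Q0 y w : adjacent_pair d y -> 0 <= Q y w by case: y => a b /coupl [].
have Q1 y : adjacent_pair d y -> \sum_w Q y w = 1.
  case: y => a b /coupl [_ QP _]; rewrite -(proj2 (tP a)).
  under [RHS]eq_bigr do rewrite -QP.
  by rewrite pair_big; apply: eq_bigr => -[].
set beta := fun n => 2 / (1 - alpha) * expR (- contraction_rate p alpha m * n.+1%:R).
have beta0 k : 0 <= beta k.
  by rewrite mulr_ge0 ?expR_ge0 // divr_ge0 // subr_ge0 ltW.
apply: tv_dist_le tP stP (proj1 dP) _ x => phi lip x y.
apply: (@le_trans _ _ ((d x y)%:R * beta n)).
  apply: lipschitz_decay dP coupl beta0 _ lip n x y => -[a b] k ab.
  apply: stopped_renewal => //.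
  - exact: chain.
  - exact: rate.
  - exact: contr.
  - move=> z nz pos; apply: le_trans dm; rewrite ler_nat.
    have zD : (d z.1 z.2 < (diameter d).+1)%N.
      by rewrite ltnS leq_diameter.
    apply: (bigop.bigmax_sup (a, b)) => //.
    exact: (bigop.bigmax_sup (Ordinal zD)).
by rewrite ler_wpM2r // ler_nat leq_diameter.
Qed.

Lemma mixed_from_bound eps :
  0 < eps -> (exists x y, unit_pair d x y) ->
  mixed_from P pi eps
    (Num.truncn (p^-1 * (3 / (1 - alpha)) * ln (expR 1 * m)
       * ln (2 * (diameter d)%:R / (eps * (1 - alpha))))).
Proof.
move=> e0 [x0 [y0 xy0]] t; set D1 := (diameter d)%:R : R.
have D1_ge1 : 1 <= D1.
  by rewrite ler1n -(eqP xy0) leq_diameter.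
set B := _ * ln _ => Bt.
apply: bigmax_le => [|x _]; first exact: ltW.
apply: le_trans (tv_dist_decay t x) _.
have da : 0 < 1 - alpha by rewrite subr_gt0.
have g0 : 0 < contraction_rate p alpha m.
  by apply: contraction_rate_gt0 => //; move: (m2); lra.
(* The exponent [t.+1] in the decay is what allows [B] to be rounded down. *)
have Bt1 : B <= t.+1%:R.
  by apply/ltW/(lt_le_trans (truncnS_gt B)); rewrite ler_nat ltnS.
have D10 : 0 < D1 by exact: lt_le_trans ltr01 D1_ge1.
have gB : contraction_rate p alpha m * B = ln (2 * D1 / (eps * (1 - alpha))).
  have m0 : 0 < m by move: (m2); lra.
  have lnm : 0 <= ln m by rewrite ln_ge0 //; move: (m2); lra.
  rewrite /B lnM ?posrE ?expR_gt0 // expRK /contraction_rate.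
  field; rewrite !gt_eqF //=; lra.
have : expR (- contraction_rate p alpha m * t.+1%:R) <=
    (2 * D1 / (eps * (1 - alpha)))^-1.
  rewrite -[leRHS]lnK ?posrE ?invr_gt0 ?divr_gt0 ?mulr_gt0 //.
  rewrite ler_expR lnV ?posrE ?divr_gt0 ?mulr_gt0 // -gB mulNr lerN2.
  by rewrite ler_pM2l.
move=> le_exp.
have K0 : 0 <= D1 * (2 / (1 - alpha)) by rewrite mulr_ge0 ?divr_ge0 // ltW.
rewrite mulrA; apply: le_trans (ler_wpM2l K0 le_exp) _.
have -> : D1 * (2 / (1 - alpha)) / (2 * D1 / (eps * (1 - alpha))) = eps.
  by field; rewrite !gt_eqF.
exact: lexx.
Qed.

End MixingBound.

(** * Existence of the mixing time and the final bound *)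

Lemma mixing_time_exists (R : realType) (Omega : finType)
    (P : Omega -> Omega -> R) (pi : Omega -> R) (eps : R) t :
  mixed_from P pi eps t ->
  exists tau, is_mixing_time P pi eps tau /\ (tau <= t)%N.
Proof.
move=> mt.
have ex : exists s, `[< mixed_from P pi eps s >] by exists t; apply/asboolP.
case: (ex_minnP ex) => tau /asboolP mtau min_tau; exists tau.
by split; [split=> // s ms|]; apply/min_tau/asboolP.
Qed.

(** The distance at T is never 1, by the definition of T, so a positive maximum is at least 2. *)
Lemma max_stop_dist_gt1 (R : realType) (Omega : finType)
    (d : Omega -> Omega -> nat) (disp : measure_display)
    (W : measurableType disp) (Pr : Omega * Omega -> probability W R)
    (Z : nat -> W -> Omega * Omega) :
  (0 < max_stop_dist d Pr Z)%N -> (1 < max_stop_dist d Pr Z)%N.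
Proof.
rewrite !ltnNge; apply: contra => /bigmax_leqP le1.
apply/bigmax_leqP => z az; apply/bigmax_leqP => k pk.
have := le1 z az => /bigmax_leqP /(_ k pk).
case k1: (k : nat) => [|[|//]] // _; move: pk; rewrite k1.
have -> : [set w | stop_dist d (Z ^~ w) = 1%N] = set0.
  by apply/seteqP; split=> w //= /eqP; rewrite (negPf (stop_dist_neq1 _ _)).
by rewrite measure0 ltxx.
Qed.

(* Under [Pr (x, y)] the process [Z t = (X_t, Y_t)] starts at (x, y).  The
   logarithm of e * D_2 is only defined for D_2 > 0, which also entails that
   some pair is at distance 1, hence D_1 > 0. *)
Theorem theorem2p1 (R : realType) (Omega : finType)
    (P : Omega -> Omega -> R) (pi : Omega -> R)
    (d : Omega -> Omega -> nat)
    (Q : Omega * Omega -> Omega * Omega -> R)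
    (disp : measure_display) (W : measurableType disp)
    (Pr : Omega * Omega -> probability W R)
    (Z : nat -> W -> Omega * Omega)
    (p alpha eps : R) :
  is_transition P ->
  is_stationary P pi ->
  is_path_metric d ->
  is_path_coupling d P Q ->
  (forall x y, unit_pair d x y -> is_markov_chain Q (Pr (x, y)) Z (x, y)) ->
  0 < p -> alpha < 1 ->
  (forall x y, unit_pair d x y -> forall t : nat, (1 <= t)%N ->
     (0 < Pr (x, y) [set w | stop_ge d t (Z ^~ w)])%E ->
     p <= cond_prob (Pr (x, y))
            [set w | stop_time d (Z ^~ w) = Some t]
            [set w | stop_ge d t (Z ^~ w)]) ->
  (forall x y, unit_pair d x y ->
     ('E_(Pr (x, y)) [fun w => (stop_dist d (Z ^~ w))%:R] <= alpha%:E)%E) ->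
  0 < eps -> eps < 1 ->
  let D1 := diameter d in
  let D2 := max_stop_dist d Pr Z in
  exists tau : nat,
    is_mixing_time P pi eps tau /\
    ((0 < D2)%N ->
     tau%:R <= p^-1 * (3 / (1 - alpha)) * ln (expR 1 * D2%:R)
                 * ln (2 * D1%:R / (eps * (1 - alpha)))).
Proof.
move=> tP stP dP cQ chain p0 a1 rate contr e0 e1 D1 D2.
(* Without adjacent pairs, geodesics are trivial and all states coincide: the chain is mixed at time
   0, and [D2], a maximum over the empty set, is 0. *)
have [adj|nadj] := pselect (exists x y, unit_pair d x y); last first.
  have eq_states (x y : Omega) : x = y.
    have [s [ps ls _]] := dP.2 x y; case: s ps ls => [//|z s] /= /andP[xz _] _.
    by case: nadj; exists x, z.
  have m0 : mixed_from P pi eps 0.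
    move=> t _; apply: bigmax_le => [|x _]; first exact: ltW.
    apply: le_trans (ltW e0); apply: tv_dist_le tP stP dP.1 _ x => phi _ x y.
    by rewrite (eq_states x y) subrr normr0.
  have [tau [mtau _]] := mixing_time_exists m0.
  exists tau; split=> //; rewrite /D2 /max_stop_dist big_pred0 // => z.
  by apply/negP => az; apply: nadj; exists z.1, z.2.
(* Here [D2] may still be 0; the maximum with 2 gives a mixing time in every case, and [m] is [D2]
   itself once [D2] is positive. *)
pose m : R := (maxn D2 2)%:R.
have m2 : 2 <= m by rewrite ler_nat leq_maxr.
have D2m : D2%:R <= m by rewrite ler_nat leq_maxl.
have mix := mixed_from_bound tP stP dP cQ chain p0 a1 rate contr m2 D2m e0 adj.
have [tau [mtau tauB]] := mixing_time_exists mix.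
exists tau; split=> // D20.
have <- : m = D2%:R by rewrite /m (maxn_idPl _) // max_stop_dist_gt1.
(* [Num.truncn] sends negative reals to 0, so the bound must be shown nonnegative; for its last
   logarithm this follows from [eps * (1 - alpha) <= 1 <= D1%:R]. *)
rewrite -(ler_nat R) in tauB; apply: le_trans tauB _; rewrite truncn_le.
have [x [y xy]] := adj.
have a0 : 0 <= alpha.
  rewrite -lee_fin; apply: le_trans (contr x y xy).
  by have := sum_stop_dist_le d (chain x y xy) 0; rewrite big_ord0.
have D1_ge1 : 1 <= D1%:R :> R by rewrite ler1n -(eqP xy) leq_diameter.
apply: mulr_ge0; last first.
  rewrite ln_ge0 // ler_pdivlMr ?mulr_gt0 ?subr_gt0 // mul1r.
  have : eps * (1 - alpha) <= 1 by rewrite mulr_ile1 ?subr_ge0 ?gerBl // ltW.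
  by lra.
apply: mulr_ge0; last first.
  by rewrite lnM ?posrE ?expR_gt0 ?expRK ?addr_ge0 ?ln_ge0 //; lra.
by rewrite mulr_ge0 ?invr_ge0 ?divr_ge0 ?subr_ge0 // ltW.
Qed.
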